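(* Suppose $(U,S)$ is an action pair in a monoid $M$ (with identity $1$) such that: (i) $U$ is a submonoid of $M$; (ii) $U\setminus\{1\}$ is a subsemigroup of $U$, and $U\setminus\{1\}\subseteq US$; (iii) $(U,S^1)$ is an action pair in $M$ extending $(U,S)$. Then, with the notation of the context, the semigroup $US$ has presentation $$\operatorname{Sgp}\langle X_U\cup X_S:R_U\cup R_S\cup R_1\cup R_2\cup R_3\rangle$$ via the morphism $\Phi:(X_U\cup X_S)^+\to US$ determined by $x\mapsto x\phi_U$ for $x\in X_U$ and $x\mapsto x\phi_S$ for $x\in X_S$, where $$R_1=\{(xy,\,{}^xy\cdot x):x\in X_S,\ y\in X_U\},$$ $$R_2=\{(N_U(u)N_S(s),\,N_U(u)N_S(t)):u\in U\setminus\{1\},\ (s,t)\in\Omega_u\},$$ $$R_3=\{(x,\,x^+x):x\in X_S,\ \overline x^+\neq1\},$$ with ${}^xy=N_U({}^{\overline x}\,\overline y)\in X_U^*$ and $x^+=N_U(\overline x^+)\in X_U^*$ for $x\in X_S$, $y\in X_U$.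
   Context: Action pairs. For a subsemigroup $U$ of a monoid $M$ with identity $1$, $U^1=U\cup\{1\}$. An action pair in $M$ is a pair $(U,S)$ of subsemigroups of $M$ with a left action $(s,u)\mapsto{}^su$ of $S$ on $U^1$ by semigroup morphisms (${}^s({}^tu)={}^{st}u$ and ${}^s(uv)={}^su\cdot{}^sv$) such that (A1) $s\cdot u={}^su\cdot s$ for all $s\in S$, $u\in U^1$, and (A2) $us=vt\Rightarrow u\cdot{}^s1=v\cdot{}^t1$ for all $u,v\in U^1$, $s,t\in S$. Write $s^+={}^s1$. $US=\{us:u\in U,s\in S\}$. ''$(U,S^1)$ is an action pair extending $(U,S)$'' means that $(U,S^1)$ is an action pair in $M$ with the map $S\to U^1:s\mapsto s^+$ being the restriction of the corresponding map $S^1\to U^1$ (equivalently, the action of $S$ is the restriction of that of $S^1$). Right congruences. For $u\in U$, $\Theta_u=\{(s,t)\in S^1\times S^1:us=ut\}$ is a right congruence on $S^1$; for each $u\in U\setminus\{1\}$, $\Omega_u\subseteq S^1\times S^1$ is a fixed set of pairs generating $\Theta_u$ as a right congruence on $S^1$. Presentations. $X^+$ is the free semigroup of non-empty words over $X$, and $X^*=X^+\cup\{\iota\}$ with $\iota$ the empty word; for $R\subseteq X^+\times X^+$, $R^\sharp$ is the congruence on $X^+$ generated by $R$. A semigroup $T$ has presentation $\operatorname{Sgp}\langle X:R\rangle$ via $\phi$ if $\phi:X^+\to T$ is a surjective morphism with kernel $R^\sharp$. A normal form function is a map $N:T\to X^+$ with $N(t)\phi=t$ for all $t\in T$. Maps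 are written on the right. Fixed data. $U\setminus\{1\}$ has presentation $\operatorname{Sgp}\langle X_U:R_U\rangle$ via $\phi_U:X_U^+\to U\setminus\{1\}$, and $S$ has presentation $\operatorname{Sgp}\langle X_S:R_S\rangle$ via $\phi_S:X_S^+\to S$, where $X_U\cap X_S=\varnothing$ and $\phi_U|_{X_U}$, $\phi_S|_{X_S}$ are injective. Write $\overline w=w\phi_U$ for $w\in X_U^+$ and $\overline w=w\phi_S$ for $w\in X_S^+$. $N_U:U\setminus\{1\}\to X_U^+$ and $N_S:S\to X_S^+$ are fixed normal form functions with $N_U(\overline x)=x$ for $x\in X_U$ and $N_S(\overline y)=y$ for $y\in X_S$. By convention $N_U(1)=\iota$; if $1\notin S$ then also $N_S(1)=\iota$ (if $1\in S$, $N_S(1)$ is the given non-empty word mapping to $1$).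
   Formalization: Added hypothesis: if 1 ∈ S then U = {1}; otherwise the claim is false, since when 1 ∈ S every defining relation preserves the presence of letters of X_S, so for u ∈ U∖{1} the words N_U(u) and N_U(u)N_S(1), both representing u, are never identified. *)

(* Defs.v *)
From HB Require Import structures.
From mathcomp Require Import all_boot.
From mathcomp Require Import classical_sets.
Set Implicit Arguments.
Unset Strict Implicit.
Unset Printing Implicit Defensive.

Local Open Scope group_scope.
Local Open Scope classical_set_scope.

Section ActionPairs.
Variable M : monoidType.
Implicit Types U S T : set M.

Definition subsemigroup T : Prop := forall x y, T x -> T y -> T (x * y).

Definition submonoid T : Prop := T 1 /\ subsemigroup T.

(* T^1: the identity adjoined is that of M, so T^1 = T when 1 is in T. *)
Definition adjoin1 T : set M := T `|` [set 1].

Definition set_mul U S : set M := [set u * s | u in U & s in S].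

(* [act s u] is ^s u; it is only meaningful for s in S and u in U^1. *)
Record action_pair U S (act : M -> M -> M) : Prop := ActionPair {
  action_pair_subsemigroupl : subsemigroup U;
  action_pair_subsemigroupr : subsemigroup S;
  action_pair_closed : forall s u,
    S s -> adjoin1 U u -> adjoin1 U (act s u);
  action_pair_actM : forall s t u,
    S s -> S t -> adjoin1 U u -> act s (act t u) = act (s * t) u;
  action_pair_actMr : forall s u v,
    S s -> adjoin1 U u -> adjoin1 U v -> act s (u * v) = act s u * act s v;
  action_pair_A1 : forall s u,
    S s -> adjoin1 U u -> s * u = act s u * s;
  action_pair_A2 : forall u v s t,
    adjoin1 U u -> adjoin1 U v -> S s -> S t ->
    u * s = v * t -> u * act s 1 = v * act t 1 }.

(* (U, S^1) is an action pair extending (U, S). *)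
Definition extends_to_adjoin1 U S (act : M -> M -> M) : Prop :=
  exists act1 : M -> M -> M,
    action_pair U (adjoin1 S) act1 /\
    (forall s, S s -> act1 s 1 = act s 1).

End ActionPairs.

Definition equivalence_on {A : Type} (D : set A) (r : set (A * A)) : Prop :=
  [/\ r `<=` D `*` D,
      forall x, D x -> r (x, x),
      forall x y, r (x, y) -> r (y, x)
    & forall x y z, r (x, y) -> r (y, z) -> r (x, z)].

Section RightCongruences.
Variable M : monoidType.

Definition right_congruence (T : set M) (r : set (M * M)) : Prop :=
  equivalence_on T r /\
  (forall x y a, r (x, y) -> T a -> r (x * a, y * a)).

Definition right_congruence_gen (T : set M) (G : set (M * M)) : set (M * M) :=
  smallest (right_congruence T) G.

Definition Theta (S : set M) (u : M) : set (M * M) :=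
  [set p | [/\ adjoin1 S p.1, adjoin1 S p.2 & u * p.1 = u * p.2]].

End RightCongruences.

Section Presentations.
Variable X : Type.

(* X^+ as a subset of X^* = seq X; the empty word is [::]. *)
Definition nonempty_words : set (seq X) := [set w | w <> [::]].

Definition word_congruence (r : set (seq X * seq X)) : Prop :=
  [/\ equivalence_on nonempty_words r,
      forall v w a, r (v, w) -> nonempty_words a -> r (a ++ v, a ++ w)
    & forall v w a, r (v, w) -> nonempty_words a -> r (v ++ a, w ++ a)].

Definition word_congruence_gen (R : set (seq X * seq X)) :
  set (seq X * seq X) := smallest word_congruence R.

Variable M : monoidType.

(* T has presentation Sgp<X : R> via the restriction of phi to X^+; the value
   of phi at the empty word is irrelevant. *)
Record presentation (T : set M) (R : set (seq X * seq X)) (phi : seq X -> M) :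
    Prop := Presentation {
  presentation_semigroup : subsemigroup T;
  presentation_rel : R `<=` nonempty_words `*` nonempty_words;
  presentation_morph : forall v w, nonempty_words v -> nonempty_words w ->
    phi (v ++ w) = phi v * phi w;
  presentation_image : phi @` nonempty_words = T;
  presentation_kernel :
    [set p | [/\ nonempty_words p.1, nonempty_words p.2 & phi p.1 = phi p.2]]
    = word_congruence_gen R }.

Definition normal_form_function (T : set M) (phi : seq X -> M)
    (N : M -> seq X) : Prop :=
  forall t, T t -> nonempty_words (N t) /\ phi (N t) = t.

End Presentations.

(* The union of the disjoint alphabets X_U and X_S is the sum type XU + XS. *)
Section PresentationUS.
Variables (M : monoidType) (XU XS : Type).
Variables (U : set M) (act : M -> M -> M).
Variables (phiU : seq XU -> M) (phiS : seq XS -> M).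
Variables (NU : M -> seq XU) (NS : M -> seq XS).

Definition wordU (w : seq XU) : seq (XU + XS) := map inl w.
Definition wordS (w : seq XS) : seq (XU + XS) := map inr w.

Definition lift_rel {X : Type} (f : seq X -> seq (XU + XS))
    (R : set (seq X * seq X)) : set (seq (XU + XS) * seq (XU + XS)) :=
  [set (f p.1, f p.2) | p in R].

Definition Phi (w : seq (XU + XS)) : M :=
  \prod_(z <- w) match z with
                 | inl x => phiU [:: x]
                 | inr x => phiS [:: x]
                 end.

Definition R1 : set (seq (XU + XS) * seq (XU + XS)) :=
  [set r | exists (x : XS) (y : XU),
     r = (wordS [:: x] ++ wordU [:: y],
          wordU (NU (act (phiS [:: x]) (phiU [:: y]))) ++ wordS [:: x])].

Definition R2 (Omega : M -> set (M * M)) :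
    set (seq (XU + XS) * seq (XU + XS)) :=
  [set r | exists u s t, [/\ (U `\ 1) u, Omega u (s, t) &
     r = (wordU (NU u) ++ wordS (NS s), wordU (NU u) ++ wordS (NS t))]].

Definition R3 : set (seq (XU + XS) * seq (XU + XS)) :=
  [set r | exists x : XS, act (phiS [:: x]) 1 <> 1 /\
     r = (wordS [:: x],
          wordU (NU (act (phiS [:: x]) 1)) ++ wordS [:: x])].

End PresentationUS.

(* Main.v *)
Require Import Defs.
From mathcomp Require Import all_boot.
From mathcomp Require Import classical_sets boolp.

Local Open Scope group_scope.
Local Open Scope classical_set_scope.

Set Implicit Arguments.
Unset Strict Implicit.
Unset Printing Implicit Defensive.

(** Write [~~] for the congruence that the proposed relations generate on the
    free monoid over the two alphabets. That the relations hold in $US$ is (A1)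
    together with $s^+s={}^s1\cdot s=s\cdot 1=s$; the work is completeness.

    Assume first that $1\notin S$. Neither $U\setminus\{1\}$ nor $S$ then
    contains $1$, so words over $X_U$, or over $X_S$, that have the same value
    are congruent, empty words included ([cong_wordU], [cong_wordS]). The
    relations $R_1$ move a letter of $X_S$ to the right of any word over $X_U$
    ([letter_past_word]), hence every word is congruent to some $pw$ with $p$
    over $X_U$ and $w$ over $X_S$ ([word_splits]). Iterating $R_3$, with $R_1$
    to move the words produced out of the way, gives
    $w\sim N_U(s^+)w$, where $s=\overline w$ ([word_absorbs_plus]), so that
    $pw\sim N_U(us^+)N_S(s)$ with $u=\overline p$ ([cong_normal_form]).

    Now let two words have values $us=vt$ with $u,v\in U$ and $s,t\in S^1$.
    Condition (A2) for $(U,S^1)$ says that $us^+=vt^+$; call this element $r$.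
    Then $rs=us=vt=rt$. If $r=1$, this means $s=t$ and the two normal forms
    coincide. Otherwise $(s,t)\in\Theta_r$, and
    $N_U(r)N_S(s)\sim N_U(r)N_S(t)$ because the pairs with this property form a
    right congruence that contains $\Omega_r$ by $R_2$ ([cong_of_Theta]).

    If $1\in S$, then $U=\{1\}$, the alphabet $X_U$ is empty, and the
    relations of $S$ suffice ([cong_complete_unital]). *)

(** * Words and the congruences they carry *)

Section Words.
Variables (M : monoidType) (X : Type).
Implicit Types (g : X -> M) (T : set M) (v w a b : seq X).
Implicit Types (R : set (seq X * seq X)).

Definition eval g w : M := \prod_(x <- w) g x.

Lemma eval_nil g : eval g [::] = 1. Proof. exact: big_nil. Qed.

Lemma eval_cons g x w : eval g (x :: w) = g x * eval g w.
Proof. exact: big_cons. Qed.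

Lemma eval_cat g v w : eval g (v ++ w) = eval g v * eval g w.
Proof.
elim: v => [|x v IH]; first by rewrite eval_nil mul1g.
by rewrite cat_cons !eval_cons IH mulgA.
Qed.

Lemma eval1 g x : eval g [:: x] = g x.
Proof. by rewrite eval_cons eval_nil mulg1. Qed.

Lemma nonempty_catl v w : nonempty_words v -> nonempty_words (v ++ w).
Proof. by case: v. Qed.

Lemma nonempty_catr v w : nonempty_words w -> nonempty_words (v ++ w).
Proof. by case: v. Qed.

Lemma nonempty_map (Y : Type) (f : X -> Y) w :
  nonempty_words w -> nonempty_words (map f w).
Proof. by case: w. Qed.

Lemma eval_in g T w : subsemigroup T -> (forall x, T (g x)) ->
  nonempty_words w -> T (eval g w).
Proof.
move=> Tmul Tg; elim: w => // x [|y w] IH _; first by rewrite eval1.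
by rewrite eval_cons; apply: Tmul => //; apply: IH.
Qed.

(** The set of all pairs of non-empty words is a word congruence containing [R],
    which is what keeps the generated congruence among non-empty words. *)
Lemma word_congruence_genP R : R `<=` @nonempty_words X `*` @nonempty_words X ->
  word_congruence (word_congruence_gen R).
Proof.
move=> Rne.
have full : word_congruence (@nonempty_words X `*` @nonempty_words X).
  split=> [|v w a [/= hv hw] ha|v w a [/= hv hw] ha].
  - split=> //; first by move=> x y [/= hx hy]; split.
    by move=> x y z [/= hx hy] [/= hy' hz]; split.
  - by split; apply: nonempty_catl.
  - by split; apply: nonempty_catl.
split; first split.
- exact: smallest_sub.
- by move=> x hx r [[[_ rr _ _] _ _] _]; apply: rr.
- move=> x y h r hr; have [[[_ _ rs _] _ _] _] := hr.
  by apply: rs; apply: h.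
- move=> x y z h k r hr; have [[[_ _ _ rt] _ _] _] := hr.
  by apply: (rt x y z); [apply: h | apply: k].
- move=> v w a h ha r hr; have [[_ rl _] _] := hr.
  by apply: rl => //; apply: h.
- move=> v w a h ha r hr; have [[_ _ rl] _] := hr.
  by apply: rl => //; apply: h.
Qed.

Lemma eval_word_congruence g :
  word_congruence [set p | [/\ nonempty_words p.1, nonempty_words p.2
                              & eval g p.1 = eval g p.2]].
Proof.
split; first split.
- by move=> [v w] [].
- by [].
- by move=> v w [].
- by move=> x y z [/= hx hy exy] [/= _ hz eyz]; split=> //=; rewrite exy.
- move=> v w a [/= hv hw e] ha.
  by split=> /=; [apply: nonempty_catl.. | rewrite !eval_cat e].
- move=> v w a [/= hv hw e] ha.
  by split=> /=; [apply: nonempty_catl.. | rewrite !eval_cat e].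
Qed.

Lemma word_congruence_gen_eval g R v w :
  R `<=` @nonempty_words X `*` @nonempty_words X ->
  (forall v w, R (v, w) -> eval g v = eval g w) ->
  word_congruence_gen R (v, w) ->
  [/\ nonempty_words v, nonempty_words w & eval g v = eval g w].
Proof.
move=> Rne sound.
apply: (smallest_sub (eval_word_congruence g)).
by move=> [a b] h; have [/= ha hb] := Rne _ h; split=> //=; apply: sound.
Qed.

(** The congruence on the free monoid generated by [R]: since [R] relates only
    non-empty words, it adds to $R^\sharp$ nothing but the pair of empty words.
    Rewriting takes place here because the factors of the normal form
    $N_U(u)N_S(s)$ may be empty. *)
Definition monoid_cong R v w : Prop := v = w \/ word_congruence_gen R (v, w).

Section MonoidCong.
Variable R : set (seq X * seq X).
Hypothesis Rne : R `<=` @nonempty_words X `*` @nonempty_words X.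

Lemma monoid_cong_refl w : monoid_cong R w w. Proof. by left. Qed.

Lemma monoid_cong_sub v w : R (v, w) -> monoid_cong R v w.
Proof. by move=> h; right; apply: sub_gen_smallest. Qed.

Lemma monoid_cong_sym v w : monoid_cong R v w -> monoid_cong R w v.
Proof.
have [[_ _ rs _] _ _] := word_congruence_genP Rne.
by case=> [->|h]; [left | right; apply: rs].
Qed.

Lemma monoid_cong_trans w v u :
  monoid_cong R v w -> monoid_cong R w u -> monoid_cong R v u.
Proof.
have [[_ _ _ rt] _ _] := word_congruence_genP Rne.
by case=> [-> //|h] [<-|k]; right=> //; apply: rt h k.
Qed.

Lemma monoid_cong_cat v v' w w' : monoid_cong R v v' -> monoid_cong R w w' ->
  monoid_cong R (v ++ w) (v' ++ w').
Proof.
have [_ rl rr] := word_congruence_genP Rne.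
move=> hv hw; apply: (@monoid_cong_trans (v' ++ w)).
  case: hv => [->|hv]; first by left.
  case: w {hw} => [|x w]; first by rewrite !cats0; right.
  by right; apply: rr.
case: hw => [->|hw]; first by left.
by case: v' {hv} => [|x v']; right=> //; apply: rl.
Qed.

Lemma monoid_cong_catl v w w' : monoid_cong R w w' ->
  monoid_cong R (v ++ w) (v ++ w').
Proof. exact/monoid_cong_cat/monoid_cong_refl. Qed.

Lemma monoid_cong_catr v v' w : monoid_cong R v v' ->
  monoid_cong R (v ++ w) (v' ++ w).
Proof. by move=> h; apply: monoid_cong_cat h (monoid_cong_refl _). Qed.

Lemma monoid_cong_nonempty v w : nonempty_words v -> monoid_cong R v w ->
  word_congruence_gen R (v, w).
Proof.
by have [[_ rr _ _] _ _] := word_congruence_genP Rne => hv [<-|//]; apply: rr.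
Qed.

Lemma monoid_cong_eval g v w :
  (forall v w, R (v, w) -> eval g v = eval g w) ->
  monoid_cong R v w -> eval g v = eval g w.
Proof.
move=> sound [-> //|h].
by have [_ _ ->] := word_congruence_gen_eval Rne sound h.
Qed.

End MonoidCong.

(** * Presentations *)

Lemma eval_presentation g T R :
  subsemigroup T ->
  R `<=` @nonempty_words X `*` @nonempty_words X ->
  (forall x, T (g x)) ->
  (forall t, T t -> exists2 w, nonempty_words w & eval g w = t) ->
  (forall v w, R (v, w) -> eval g v = eval g w) ->
  (forall v w, nonempty_words v -> nonempty_words w ->
     eval g v = eval g w -> word_congruence_gen R (v, w)) ->
  presentation T R (eval g).
Proof.
move=> Tmul Rne Tg onto sound complete; split=> //.
- by move=> v w _ _; apply: eval_cat.
- apply/seteqP; split=> [t [w hw <-]|t /onto [w hw <-]]; last by exists w.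
  exact: eval_in.
- apply/seteqP; split=> [[v w] [/= hv hw e]|[v w]]; first exact: complete.
  exact: word_congruence_gen_eval.
Qed.

Section OfPresentation.
Variables (T : set M) (R : set (seq X * seq X)) (phi : seq X -> M).
Hypothesis pres : presentation T R phi.
Let g x := phi [:: x].

Lemma presentation_eval w : nonempty_words w -> eval g w = phi w.
Proof.
elim: w => // x [|y w] IH _; first by rewrite eval1.
rewrite eval_cons IH // -[x :: y :: w]/([:: x] ++ (y :: w)).
by rewrite (presentation_morph pres).
Qed.

Lemma presentation_in w : nonempty_words w -> T (phi w).
Proof. by move=> hw; rewrite -(presentation_image pres); exists w. Qed.

Lemma presentation_eval_in w : nonempty_words w -> T (eval g w).
Proof. by move=> hw; rewrite presentation_eval //; apply: presentation_in. Qed.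

Lemma presentation_eval_adjoin1 w : adjoin1 T (eval g w).
Proof.
case: w => [|x w]; first by right; rewrite eval_nil.
by left; apply: presentation_eval_in.
Qed.

Lemma presentation_complete v w : nonempty_words v -> nonempty_words w ->
  eval g v = eval g w -> word_congruence_gen R (v, w).
Proof.
move=> hv hw; rewrite !presentation_eval // => e.
by rewrite -(presentation_kernel pres).
Qed.

Lemma presentation_sound v w : R (v, w) -> eval g v = eval g w.
Proof.
move=> h; have [/= hv hw] := presentation_rel pres h.
have : word_congruence_gen R (v, w) by apply: sub_gen_smallest.
by rewrite -(presentation_kernel pres) !presentation_eval // => -[].
Qed.

(** If $1\notin T$ then the empty word is alone in representing $1$, so the
    relations of $T$ present the monoid $T^1$. *)
Lemma presentation_monoid_cong v w : ~ T 1 ->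
  eval g v = eval g w -> monoid_cong R v w.
Proof.
move=> T1; case: v w => [|x v] [|y w] e; first by left.
- by case: T1; rewrite -(eval_nil g) e; apply: presentation_eval_in.
- by case: T1; rewrite -(eval_nil g) -e; apply: presentation_eval_in.
- by right; apply: presentation_complete.
Qed.

(** With $N(1)=\iota$ when $1\notin T$, the empty value of [eval] makes the
    normal form property hold on all of $T^1$. *)
Lemma normal_form_eval N t : normal_form_function T phi N ->
  (~ T 1 -> N 1 = [::]) -> adjoin1 T t -> eval g (N t) = t.
Proof.
move=> nf N1.
have inT s : T s -> eval g (N s) = s.
  by move=> /nf [hN e]; rewrite presentation_eval.
case=> [|->]; first exact: inT.
have [/inT //|/N1 ->] := EM (T 1); exact: eval_nil.
Qed.

End OfPresentation.
End Words.

Lemma monoid_cong_map (X Y : Type) (f : X -> Y) (R : set (seq X * seq X))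
    (R' : set (seq Y * seq Y)) v w :
  R `<=` @nonempty_words X `*` @nonempty_words X ->
  R' `<=` @nonempty_words Y `*` @nonempty_words Y ->
  (forall v w, R (v, w) -> R' (map f v, map f w)) ->
  monoid_cong R v w -> monoid_cong R' (map f v) (map f w).
Proof.
move=> Rne R'ne sub; case=> [->|]; first by left.
have [[_ rr rs rt] rl rr'] := word_congruence_genP R'ne.
pose r := [set p | [/\ nonempty_words p.1, nonempty_words p.2
  & word_congruence_gen R' (map f p.1, map f p.2)]].
suff : word_congruence_gen R `<=` r by move=> h /h [_ _ k]; right.
apply: smallest_sub; last first.
  move=> [a b] h; have [/= ha hb] := Rne _ h.
  by split=> //=; apply: sub_gen_smallest; apply: sub.
split; first split.
- by move=> [a b] [].
- by move=> a ha; split=> //=; apply: rr; apply: nonempty_map.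
- by move=> a b [/= ha hb h]; split=> //=; apply: rs.
- by move=> a b c [/= ha hb h] [/= _ hc k]; split=> //=; apply: rt h k.
- move=> a b c [/= ha hb h] hc; split=> /=; try exact: nonempty_catl.
  by rewrite !map_cat; apply: rl => //; apply: nonempty_map.
- move=> a b c [/= ha hb h] hc; split=> /=; try exact: nonempty_catl.
  by rewrite !map_cat; apply: rr' => //; apply: nonempty_map.
Qed.

(** * Action pairs *)

Section ActionPairFacts.
Variables (M : monoidType) (U S : set M) (act act1 : M -> M -> M).
Hypothesis hUS : action_pair U S act.
Hypothesis hUS1 : action_pair U (adjoin1 S) act1.

Lemma action_pair_1 : act1 1 1 = 1.
Proof.
have h1 : adjoin1 S 1 by right.
have h1' : adjoin1 U 1 by right.
by have := action_pair_A1 hUS1 h1 h1'; rewrite !mulg1.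
Qed.

Lemma action_pair_plus_absorb s : adjoin1 S s -> act1 s 1 * s = s.
Proof.
have h1 : adjoin1 U 1 by right.
by move=> hs; rewrite -(action_pair_A1 hUS1 hs h1) mulg1.
Qed.

(** The action is determined by the map $s\mapsto s^+$: by (A1) one has
    ${}^su\cdot s=su$ for either action, and (A2) turns this equality into one
    between ${}^su\cdot{}^s1={}^su$ for the two of them. *)
Lemma action_pair_extension_unique s u :
  (forall s, S s -> act1 s 1 = act s 1) ->
  S s -> adjoin1 U u -> act1 s u = act s u.
Proof.
move=> ext hs hu.
have h1 : adjoin1 U 1 by right.
have hs1 : adjoin1 S s by left.
have := action_pair_A2 hUS1 (action_pair_closed hUS1 hs1 hu)
  (action_pair_closed hUS hs hu) hs1 hs1.
rewrite -(action_pair_A1 hUS1 hs1 hu) -(action_pair_A1 hUS hs hu) => /(_ erefl).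
rewrite -(action_pair_actMr hUS1) // mulg1 => ->.
by rewrite ext // -(action_pair_actMr hUS) // mulg1.
Qed.

Lemma set_mul_subsemigroup : subsemigroup (set_mul U S).
Proof.
move=> _ _ [u hu [s hs <-]] [v hv [t ht <-]].
have hv1 : adjoin1 U v by left.
have e : u * act s v * (s * t) = u * s * (v * t).
  by rewrite !mulgA -(mulgA u) -(action_pair_A1 hUS) // !mulgA.
have hst : S (s * t) by apply: (action_pair_subsemigroupr hUS).
case: (action_pair_closed hUS hs hv1) => [hsv|/= hsv].
  exists (u * act s v); last by exists (s * t).
  exact: (action_pair_subsemigroupl hUS).
by exists u => //; exists (s * t) => //; rewrite -e hsv mulg1.
Qed.

End ActionPairFacts.

(** * Words over the two alphabets *)

Section ProductPresentation.
Variables (M : monoidType) (U S : set M) (act act1 : M -> M -> M).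
Variables (XU XS : Type).
Variables (RU : set (seq XU * seq XU)) (RS : set (seq XS * seq XS)).
Variables (phiU : seq XU -> M) (phiS : seq XS -> M).
Variables (NU : M -> seq XU) (NS : M -> seq XS).
Variable Omega : M -> set (M * M).
Hypothesis hUS : action_pair U S act.
Hypothesis hU : submonoid U.
Hypothesis hU1US : U `\ 1 `<=` set_mul U S.
Hypothesis hUS1 : action_pair U (adjoin1 S) act1.
Hypothesis hext : forall s, S s -> act1 s 1 = act s 1.
Hypothesis h1S : S 1 -> U = [set 1].
Hypothesis hpresU : presentation (U `\ 1) RU phiU.
Hypothesis hpresS : presentation S RS phiS.
Hypothesis hNU : normal_form_function (U `\ 1) phiU NU.
Hypothesis hNS : normal_form_function S phiS NS.
Hypothesis hNU1 : NU 1 = [::].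
Hypothesis hNS1 : ~ S 1 -> NS 1 = [::].
Hypothesis hOmega : forall u, (U `\ 1) u ->
  Omega u `<=` adjoin1 S `*` adjoin1 S /\
  right_congruence_gen (adjoin1 S) (Omega u) = Theta S u.

Let gU (y : XU) := phiU [:: y].
Let gS (x : XS) := phiS [:: x].
Let g (z : XU + XS) := match z with inl y => gU y | inr x => gS x end.
Let wordU := @wordU XU XS.
Let wordS := @wordS XU XS.
Let R := lift_rel wordU RU `|` lift_rel wordS RS `|`
  R1 act phiU phiS NU `|` R2 U NU NS Omega `|` R3 act phiS NU.
Local Notation "v ~~ w" := (monoid_cong R v w) (at level 70).

Lemma eval_wordU p : eval g (wordU p) = eval gU p.
Proof. by rewrite /eval big_map. Qed.

Lemma eval_wordS w : eval g (wordS w) = eval gS w.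
Proof. by rewrite /eval big_map. Qed.

Lemma gU_in y : (U `\ 1) (gU y).
Proof. exact: (presentation_in hpresU). Qed.

Lemma gS_in x : S (gS x).
Proof. exact: (presentation_in hpresS). Qed.

Lemma evalU_in p : U (eval gU p).
Proof.
by case: (presentation_eval_adjoin1 hpresU p) => [[]|/= ->] //; case: hU.
Qed.

Lemma evalS_in w : adjoin1 S (eval gS w).
Proof. exact: (presentation_eval_adjoin1 hpresS). Qed.

Lemma eval_NU u : U u -> eval gU (NU u) = u.
Proof.
move=> hu; apply: (normal_form_eval hpresU hNU) => //.
by have [->|u1] := EM (u = 1); [right | left].
Qed.

Lemma eval_NS s : adjoin1 S s -> eval gS (NS s) = s.
Proof. exact: (normal_form_eval hpresS hNS). Qed.

Lemma act_in s u : S s -> U u -> U (act s u).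
Proof.
move=> hs hu; have hu1 : adjoin1 U u by left.
by case: (action_pair_closed hUS hs hu1) => [//|->]; case: hU.
Qed.

Lemma plus_in s : adjoin1 S s -> U (act1 s 1).
Proof.
have hU1 : adjoin1 U 1 by right.
by move=> hs; case: (action_pair_closed hUS1 hs hU1) => [//|->]; case: hU.
Qed.

Lemma relation_nonempty :
  R `<=` @nonempty_words (XU + XS) `*` @nonempty_words (XU + XS).
Proof.
move=> [v w] [[[[|]|]|]|].
- move=> [[a b] /(presentation_rel hpresU) [/= ha hb] [<- <-]].
  by split; apply: nonempty_map.
- move=> [[a b] /(presentation_rel hpresS) [/= ha hb] [<- <-]].
  by split; apply: nonempty_map.
- by move=> [x [y [-> ->]]]; split=> //=; apply: nonempty_catr.
- move=> [u [s [t [hu _ [-> ->]]]]]; have [hN _] := hNU hu.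
  by split; apply/nonempty_catl/nonempty_map.
- by move=> [x [_ [-> ->]]]; split=> //=; apply: nonempty_catr.
Qed.

Lemma relation_sound v w : R (v, w) -> eval g v = eval g w.
Proof.
have U1 : adjoin1 U 1 by right.
case=> [[[[|]|]|]|].
- move=> [[a b] /(presentation_sound hpresU) /= e [<- <-]].
  by rewrite !eval_wordU.
- move=> [[a b] /(presentation_sound hpresS) /= e [<- <-]].
  by rewrite !eval_wordS.
- move=> [x [y [-> ->]]].
  rewrite eval_cat eval_wordU eval1 eval_cons eval1 -/(gS x) -/(gU y) /=.
  have [hy _] := gU_in y; have hx := gS_in x.
  rewrite eval_NU; last exact: act_in.
  by rewrite -(action_pair_A1 hUS) //; left.
- move=> [u [s [t [hu hst [-> ->]]]]].
  have [_ gen] := hOmega hu.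
  have : Theta S u (s, t) by rewrite -gen; apply: sub_gen_smallest.
  move=> [/= hs ht e]; rewrite !eval_cat !eval_wordU !eval_wordS.
  by rewrite !eval_NS // eval_NU //; case: hu.
- move=> [x [_ [-> ->]]]; rewrite eval_cat eval_wordU !eval1 -/(gS x) /=.
  have hx := gS_in x.
  rewrite eval_NU; last by apply: act_in => //; case: hU.
  by rewrite -(action_pair_A1 hUS) // mulg1.
Qed.

Lemma cong_wordU p q : eval gU p = eval gU q -> wordU p ~~ wordU q.
Proof.
move=> e; apply: monoid_cong_map (presentation_rel hpresU) relation_nonempty
  _ _.
  by move=> a b h; left; left; left; left; exists (a, b).
by apply: (presentation_monoid_cong hpresU) e => -[_] /(_ erefl).
Qed.

Lemma lift_RS a b : RS (a, b) -> R (wordS a, wordS b).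
Proof. by move=> h; left; left; left; right; exists (a, b). Qed.

Lemma cong_wordS v w : ~ S 1 -> eval gS v = eval gS w -> wordS v ~~ wordS w.
Proof.
move=> S1 e.
apply: monoid_cong_map (presentation_rel hpresS) relation_nonempty lift_RS _.
exact: (presentation_monoid_cong hpresS).
Qed.

Let cong_trans := monoid_cong_trans relation_nonempty.
Let cong_sym := monoid_cong_sym relation_nonempty.
Let cong_catl := monoid_cong_catl relation_nonempty.
Let cong_catr := monoid_cong_catr relation_nonempty.

(** By induction on $p$, using $R_1$ for each letter. The words
    $N_U({}^xy)$ picked up on the way multiply to ${}^x\overline p$, so the
    relations of $U\setminus\{1\}$ bring them to normal form. The base case
    $x\sim N_U(x^+)x$ is $R_3$, or trivial when $x^+=1$. *)
Lemma letter_past_word x p :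
  wordS [:: x] ++ wordU p ~~
  wordU (NU (act (gS x) (eval gU p))) ++ wordS [:: x].
Proof.
have hx := gS_in x; have hU1 : U 1 by case: hU.
elim: p => [|y p IH].
  rewrite eval_nil; have [->|h] := EM (act (gS x) 1 = 1).
    by rewrite hNU1; left.
  by apply: monoid_cong_sub; right; exists x.
have [hy _] := gU_in y; have hp := evalU_in p.
have step1 : wordS [:: x] ++ wordU [:: y] ~~
    wordU (NU (act (gS x) (gU y))) ++ wordS [:: x].
  by apply: monoid_cong_sub; left; left; right; exists x, y.
apply: cong_trans (cong_catr (wordU p) step1) _.
rewrite -catA; apply: cong_trans (cong_catl _ IH) _.
rewrite catA -[X in X ++ _]map_cat; apply/cong_catr/cong_wordU.
rewrite eval_cat eval_cons !eval_NU; try exact: act_in.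
  by rewrite (action_pair_actMr hUS) //; left.
by apply: act_in => //; case: hU => _; apply.
Qed.

(** By induction: if $w\sim N_U(s^+)w$, then moving $x$ past $N_U(s^+)$ in
    $xN_U(s^+)w$ yields $N_U({}^x(s^+))xw$, and
    ${}^x({}^s1)={}^{xs}1=(xs)^+$. *)
Lemma word_absorbs_plus w :
  wordS w ~~ wordU (NU (act1 (eval gS w) 1)) ++ wordS w.
Proof.
have hU1 : adjoin1 U 1 by right.
elim: w => [|x w IH].
  by rewrite eval_nil (action_pair_1 hUS1) hNU1; left.
have hx := gS_in x; have hx1 : adjoin1 S (gS x) by left.
have hw := evalS_in w.
have hplus := plus_in hw.
apply: cong_trans (cong_catl (wordS [:: x]) IH) _.
rewrite catA; apply: cong_trans (cong_catr _ (letter_past_word _ _)) _.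
rewrite eval_NU // -catA; left; congr (wordU (NU _) ++ _).
rewrite eval_cons -(action_pair_actM hUS1) //.
by apply/esym/(action_pair_extension_unique hUS hUS1 hext) => //; left.
Qed.

Lemma word_splits w : exists p v, w ~~ wordU p ++ wordS v.
Proof.
elim: w => [|[y|x] w [p [v h]]]; first by exists [::], [::]; left.
  by exists (y :: p), v; apply: (cong_catl [:: inl y] h).
exists (NU (act (gS x) (eval gU p))), (x :: v).
apply: cong_trans (cong_catl [:: inr x] h) _.
by rewrite catA; apply: cong_trans (cong_catr _ (letter_past_word x p)) _;
  rewrite -catA; left.
Qed.

(** The relation $R_2$ puts $\Omega_q$ into the set of pairs $(s,t)$ satisfying
    the conclusion. This set is stable under right multiplication by $c$ because
    $N_S(a)N_S(c)\sim N_S(ac)$ on $S^1$. *)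
Lemma cong_of_Theta q s t : ~ S 1 -> (U `\ 1) q -> Theta S q (s, t) ->
  wordU (NU q) ++ wordS (NS s) ~~ wordU (NU q) ++ wordS (NS t).
Proof.
move=> S1 hq; have [Osub <-] := hOmega hq.
pose r := [set a : M * M | [/\ adjoin1 S a.1, adjoin1 S a.2 &
  wordU (NU q) ++ wordS (NS a.1) ~~ wordU (NU q) ++ wordS (NS a.2)]].
suff : right_congruence_gen (adjoin1 S) (Omega q) `<=` r by move=> h /h [].
apply: smallest_sub; last first.
  move=> [a b] h; have [/= ha hb] := Osub _ h; split=> //=.
  by apply: monoid_cong_sub; left; right; exists q, a, b.
have Smul : subsemigroup (adjoin1 S) := action_pair_subsemigroupr hUS1.
have NSM a b : adjoin1 S a -> adjoin1 S b ->
    wordS (NS a) ++ wordS (NS b) ~~ wordS (NS (a * b)).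
  move=> ha hb; rewrite -map_cat; apply: cong_wordS => //.
  by rewrite eval_cat !eval_NS //; apply: Smul.
split; first split.
- by move=> [a b] [].
- by move=> a ha; split=> //; left.
- by move=> a b [/= ha hb h]; split=> //=; apply: cong_sym.
- by move=> a b c [/= ha hb h] [/= _ hc k]; split=> //=; apply: cong_trans h k.
- move=> a b c [/= ha hb h] hc; split=> /=; try exact: Smul.
  apply: cong_trans (cong_sym (cong_catl _ (NSM _ _ ha hc))) _.
  apply: cong_trans (cong_catl _ (NSM _ _ hb hc)).
  by rewrite !catA; apply: cong_catr.
Qed.

Lemma cong_normal_form p w : ~ S 1 ->
  wordU p ++ wordS w ~~
  wordU (NU (eval gU p * act1 (eval gS w) 1)) ++ wordS (NS (eval gS w)).
Proof.
move=> S1; have hw := evalS_in w.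
have hplus := plus_in hw.
apply: cong_trans (cong_catl _ (word_absorbs_plus w)) _.
rewrite catA -[X in X ++ _]map_cat.
apply: (@cong_trans (wordU (NU (eval gU p * act1 (eval gS w) 1)) ++ wordS w)).
  apply/cong_catr/cong_wordU; rewrite eval_cat !eval_NU //.
  by case: hU => _; apply=> //; apply: evalU_in.
by apply/cong_catl/cong_wordS => //; rewrite eval_NS.
Qed.

(** Condition (A2) matches the $U$-parts of the two normal forms; what is left
    is an instance of $\Theta$. *)
Lemma cong_complete v w : ~ S 1 -> eval g v = eval g w -> v ~~ w.
Proof.
move=> S1 e.
have [p [a hv]] := word_splits v; have [q [b hw]] := word_splits w.
have inv := monoid_cong_eval relation_nonempty relation_sound.
have euv : eval gU p * eval gS a = eval gU q * eval gS b.
  rewrite -!eval_wordU -!eval_wordS -!eval_cat.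
  by rewrite -(inv _ _ hv) -(inv _ _ hw).
apply: cong_trans hv _; apply: cong_sym.
apply: cong_trans hw _; apply: cong_sym.
apply: cong_trans (cong_normal_form p a S1) _.
apply: cong_sym; apply: cong_trans (cong_normal_form q b S1) _; apply: cong_sym.
have ha := evalS_in a; have hb := evalS_in b.
have hp : adjoin1 U (eval gU p) by left; apply: evalU_in.
have hq : adjoin1 U (eval gU q) by left; apply: evalU_in.
have eplus := action_pair_A2 hUS1 hp hq ha hb euv.
rewrite -eplus; set r := _ * _.
have er : r * eval gS a = r * eval gS b.
  rewrite {2}/r eplus /r -!mulgA !(action_pair_plus_absorb hUS1) //.
(* $R_2$ has no instance at 1, but there $rs=rt$ already says $s=t$. *)
have [r1|r1] := EM (r = 1).
  by move: er; rewrite r1 !mul1g => ->; left.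
apply: cong_of_Theta => //; split=> //.
by case: hU => _; apply; [apply: evalU_in | apply: plus_in].
Qed.

(** Only here may a non-empty word over $X_S$ have value $1$, so the comparison
    has to be made between non-empty words. *)
Lemma cong_complete_unital v w : S 1 ->
  nonempty_words v -> nonempty_words w ->
  eval g v = eval g w -> word_congruence_gen R (v, w).
Proof.
move=> S1.
have noU (y : XU) : False by have := gU_in y; rewrite h1S // => -[].
have onlyS u : exists u', u = wordS u'.
  elim: u => [|[y|x] u [u' ->]]; first by exists [::].
    by case: (noU y).
  by exists (x :: u').
have [v' ->] := onlyS v; have [w' ->] := onlyS w.
rewrite !eval_wordS => hv hw e.
apply: (monoid_cong_nonempty relation_nonempty) => //.
apply: monoid_cong_map (presentation_rel hpresS) relation_nonempty lift_RS _.
right; apply: (presentation_complete hpresS) e.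
  by case: v' hv.
by case: w' hw.
Qed.

Lemma set_mul_presentation : presentation (set_mul U S) R (eval g).
Proof.
have U1 : U 1 by case: hU.
apply: eval_presentation.
- exact: (set_mul_subsemigroup hUS).
- exact: relation_nonempty.
- move=> [y|x]; first exact/hU1US/gU_in.
  by exists 1 => //; exists (gS x); [apply: gS_in | rewrite mul1g].
- move=> _ [u hu [s hs <-]]; exists (wordU (NU u) ++ wordS (NS s)).
    by apply: nonempty_catr; have [] := hNS hs; case: (NS s).
  by rewrite eval_cat eval_wordU eval_wordS eval_NU // eval_NS //; left.
- exact: relation_sound.
- have [S1|S1] := EM (S 1); first by move=> v w; apply: cong_complete_unital.
  move=> v w hv hw e; apply: (monoid_cong_nonempty relation_nonempty) => //.
  exact: cong_complete.
Qed.

End ProductPresentation.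

Theorem theorem6p36 (M : monoidType) (U S : set M) (act : M -> M -> M)
  (XU XS : Type)
  (RU : set (seq XU * seq XU)) (RS : set (seq XS * seq XS))
  (phiU : seq XU -> M) (phiS : seq XS -> M)
  (NU : M -> seq XU) (NS : M -> seq XS)
  (Omega : M -> set (M * M))
  (hUS : action_pair U S act)
  (hU : submonoid U)
  (hU1 : subsemigroup (U `\ 1))
  (hU1US : U `\ 1 `<=` set_mul U S)
  (hext : extends_to_adjoin1 U S act)
  (* Without this guard the claim fails: if 1 is in S, every defining relation
     preserves the presence of a letter of X_S, while u = u * 1. *)
  (h1S : S 1 -> U = [set 1])
  (hpresU : presentation (U `\ 1) RU phiU)
  (hpresS : presentation S RS phiS)
  (hphiU : injective (fun x : XU => phiU [:: x]))
  (hphiS : injective (fun x : XS => phiS [:: x]))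
  (hNU : normal_form_function (U `\ 1) phiU NU)
  (hNS : normal_form_function S phiS NS)
  (hNUx : forall x : XU, NU (phiU [:: x]) = [:: x])
  (hNSx : forall x : XS, NS (phiS [:: x]) = [:: x])
  (hNU1 : NU 1 = [::])
  (hNS1 : ~ S 1 -> NS 1 = [::])
  (hOmega : forall u, (U `\ 1) u ->
     Omega u `<=` adjoin1 S `*` adjoin1 S /\
     right_congruence_gen (adjoin1 S) (Omega u) = Theta S u) :
  presentation (set_mul U S)
    (lift_rel (@wordU XU XS) RU `|` lift_rel (@wordS XU XS) RS `|`
     R1 act phiU phiS NU `|` R2 U NU NS Omega `|` R3 act phiS NU)
    (Phi phiU phiS).
Proof.
have [act1 [hUS1 hext1]] := hext.
exact: (set_mul_presentation hUS hU hU1US hUS1 hext1 h1S hpresU hpresS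
  hNU hNS hNU1 hNS1 hOmega).
Qed.
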